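(* Let $e$ be a positive integer, let $q=2^e$, and let $n$ be any even positive integer. Then $$\binom{n-1}{1}_q\leq \chi(J_q(n,2))<2\binom{n-1}{1}_q.$$
   Context: $\binom{k}{1}_q=\frac{q^k-1}{q-1}$ (Gaussian binomial coefficient). The Grassmann graph $J_q(n,2)$ is the graph whose vertices are the $2$-dimensional subspaces of $\mathbb{F}_q^n$, two vertices being adjacent if they intersect in a $1$-dimensional subspace. $\chi(G)$ denotes the chromatic number of a graph $G$. *)

(* Defs.v *)
From HB Require Import structures.
From mathcomp Require Import all_boot all_algebra.

Set Implicit Arguments.
Unset Strict Implicit.
Unset Printing Implicit Defensive.

Record sgraph := SGraph {
  vertex :> finType;
  adj : rel vertex;
  adj_sym : symmetric adj;
  adj_irrefl : irreflexive adj
}.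

Definition proper_coloring (G : sgraph) (k : nat) (c : {ffun G -> 'I_k}) : bool :=
  [forall x, forall y, adj x y ==> (c x != c y)].

Definition colorable (G : sgraph) (k : nat) : bool :=
  [exists c : {ffun G -> 'I_k}, proper_coloring c].

Lemma colorable_exists (G : sgraph) : exists k, colorable G k.
Proof.
exists #|G|; apply/existsP; exists [ffun x => enum_rank x].
apply/forallP => x; apply/forallP => y; apply/implyP => xy.
rewrite !ffunE; apply/eqP => /enum_rank_inj eq_xy.
by rewrite eq_xy adj_irrefl in xy.
Qed.

Definition chromatic_number (G : sgraph) : nat := ex_minn (colorable_exists G).

(* Over a finite field a vector space has finitely many subspaces: they are
   represented by canonical matrices over that field. *)
Section FiniteSubspaces.
Import VectorInternalTheory.
Variables (F : finFieldType) (vT : vectType F).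
HB.instance Definition _ := [Countable of {vspace vT} by <:].
HB.instance Definition _ := [Finite of {vspace vT} by <:].
End FiniteSubspaces.

Section Grassmann.
Variables (F : finFieldType) (n : nat).

Definition plane : finType := {U : {vspace 'rV[F]_n} | \dim U == 2}.

Definition plane_adj : rel plane := fun U V => \dim (val U :&: val V)%VS == 1.

Lemma plane_adj_sym : symmetric plane_adj.
Proof. by move=> U V; rewrite /plane_adj capvC. Qed.

Lemma plane_adj_irrefl : irreflexive plane_adj.
Proof. by move=> U; rewrite /plane_adj capvv (eqP (valP U)). Qed.

(* The Grassmann graph J_q(n,2), where q = #|F|. *)
Definition grassmann_graph2 : sgraph := SGraph plane_adj_sym plane_adj_irrefl.
End Grassmann.

Definition gauss_binom1 (q k : nat) : nat := (q ^ k - 1) %/ (q - 1).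

(* The truncated operations in [gauss_binom1] are exact for prime powers q. *)
Lemma gauss_binom1_exact (q k : nat) :
  0 < q -> gauss_binom1 q k * (q - 1) + 1 = q ^ k.
Proof.
move=> q_gt0; rewrite divnK ?subnK ?expn_gt0 ?q_gt0 //.
by rewrite !subn1 dvdn_pred_predX.
Qed.

(* Main.v *)
(* Let [q = 2 ^ e] and let [L] be the extension of [F] of odd degree [m = n - 1], so
   that [F^n] is identified with [L * F].  For [u = (x, s)] and [v = (y, t)] put
     [moore u v = x^q y + x y^q + (t x + s y)^(q+1)].
   Because [m] is odd, [z |-> z^(q+1)] is injective on [L] and the fixed points of
   [z |-> z^(q^2)] are those of [z |-> z^q], whence [moore u v = moore u w] forces
   [v - w] to be a multiple of [u].  The values of [moore] on a plane [U] form an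
   additive subgroup [K U] of [L] of order [q]; it is [{moore u v | v in U}] for any
   nonzero [u] in [U], so [K U] and [K U'] meet only in [0] if [U], [U'] are adjacent.
   For a linear form [lam] on [L], each [K U] has a nonzero element with
   [lam x] in [{0, 1}]; colouring [U] by it takes [2 q^(m-1) - 1] colours.
   The lower bound comes from the clique of all planes through a point. *)
From HB Require Import structures.
Require Import Defs.
From mathcomp Require Import all_boot all_fingroup all_algebra all_field.
From mathcomp Require Import ring zify.

Set Implicit Arguments.
Unset Strict Implicit.
Unset Printing Implicit Defensive.

Import GRing.Theory VectorInternalTheory.
Local Open Scope ring_scope.

(** * Colour sets and extensions of finite fields *)

Lemma colorable_in (G : sgraph) (T : finType) (A : {set T}) (c : G -> T) :
    (forall x, c x \in A) -> (forall x y, adj x y -> c x <> c y) ->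
  colorable G #|A|.
Proof.
move=> cA c_neq; apply/existsP.
exists [ffun x => enum_rank_in (cA x) (c x)].
apply/forallP => x; apply/forallP => y; apply/implyP => xy; rewrite !ffunE.
by apply/eqP => /enum_rank_in_inj eq_c; apply: c_neq xy _; apply: eq_c.
Qed.

Lemma chromatic_number_le (G : sgraph) k :
  colorable G k -> (chromatic_number G <= k)%N.
Proof. by rewrite /chromatic_number => Gk; case: ex_minnP => i _; apply. Qed.

Lemma chromatic_number_colorable (G : sgraph) : colorable G (chromatic_number G).
Proof. by rewrite /chromatic_number; case: ex_minnP. Qed.

Lemma card_row_entry_bool (F : finFieldType) m (i0 : 'I_m) :
  (#|[set r : 'rV[F]_m | ((r 0 i0 == 0) || (r 0 i0 == 1))%R]| <= 2 * #|F| ^ m.-1)%N.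
Proof.
case: m i0 => [[] //|m] i0 /=.
rewrite -card_bool -[X in (_ * _ ^ X)%N]mul1n -card_mx -card_prod.
set A := [set _ | _].
(* The entry at [i0] carries a single bit, so this bit and the remaining entries determine the
   row. *)
pose g (r : 'rV[F]_m.+1) := (r 0 i0 == 0, col' i0 r).
have g_inj : {in A &, injective g}.
  move=> r r'; rewrite !inE => Ar Ar' [eq0 eqc]; apply/rowP => j.
  have [k ->|->] := unliftP i0 j; first by move/rowP/(_ k): eqc; rewrite !mxE.
  case: (r 0 i0 =P 0) Ar eq0 => [-> _ /esym/eqP -> //|_ /= /eqP -> eq0].
  by case: (r' 0 i0 =P 0) Ar' eq0 => //= _ /eqP ->.
by rewrite -(card_in_imset g_inj) max_card.
Qed.

(** Take the splitting field of ['X^N - 'X]: its roots are distinct and generate a field fixed by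
    the [m]-th power of Frobenius, so every element is a root and there are exactly [N]. *)
Lemma fieldExt_of_degree (F : finFieldType) m : (0 < m)%N ->
  exists L : fieldExtType F, \dim {:L} = m.
Proof.
move=> m_gt0; have q_gt1 : (1 < #|F|)%N := finNzRing_gt1 F.
set N := (#|F| ^ m)%N; have N_gt1 : (1 < N)%N.
  by rewrite -(expn0 #|F|) ltn_exp2l.
have size_q (R : nzRingType) : size ('X^N - 'X : {poly R}) = N.+1.
  by rewrite size_polyDl size_polyXn // size_polyN size_polyX.
have /FinSplittingFieldFor[L] : 'X^N - 'X != 0 :> {poly F}.
  by rewrite -size_poly_eq0 size_q.
rewrite rmorphB rmorphXn /= map_polyX => -[zs DqL defL].
exists L.
have N0 : N%:R = 0 :> L.
  have F0 : #|F|%:R = 0 :> F.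
    by rewrite -FinRing.zmodXgE -cardsT (cyclic.expg_cardG (G := [set: F]%G)) ?inE.
  by rewrite /N natrX -[_%:R](rmorph_nat (in_alg L)) F0 rmorph0 expr0n gtn_eqF.
(* Since [N] vanishes in [L], the derivative of the polynomial is -1. *)
have Uzs : uniq zs.
  rewrite -separable_prod_XsubC -(eqp_separable DqL) unlock.
  by rewrite derivB derivXn derivX -scaler_nat N0 scale0r sub0r -[-1]scaleN1r
    coprimepZr ?coprimep1 ?oppr_eq0 ?oner_neq0.
have zsE z : (z \in zs) = (z ^+ N == z).
  by rewrite -root_prod_XsubC -(eqp_root DqL) /root !hornerE subr_eq0.
have [/= a _ aE] := finField_galois_generator (sub1v {:L}%AS).
have aXE i x : (a ^+ i)%g x = x ^+ (#|F| ^ i).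
  elim: i => [|i IHi]; first by rewrite gal_id expr1.
  by rewrite expgSr galM ?memvf // IHi aE ?memvf // dimv1 expn1 -exprM expnSr.
have expN (x : L) : x ^+ N = x.
  have : (<<1 & zs>> <= fixedSpace (a ^+ m)%g)%VS.
    apply/Fadjoin_seqP; split; first exact: sub1v.
    by move=> z; rewrite zsE => /eqP zN; apply/fixedSpaceP; rewrite aXE.
  by rewrite defL => /subvP/(_ x (memvf x))/fixedSpaceP; rewrite aXE.
have cardL : #|{: finvect_type L}%VS| = N.
  apply: succn_inj; rewrite -(size_q L) (eqp_size DqL) size_prod_XsubC.
  rewrite -(card_uniqP (Uzs : uniq (zs : seq (finvect_type L)))); congr _.+1.
  by apply: eq_card => z; rewrite zsE expN eqxx memvf.
by apply/eqP; move/eqP: cardL; rewrite card_vspace eqn_exp2l.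
Qed.

(* [x'], [y'] stand for the Frobenius images of [x], [y]. *)
Lemma moore_det_char2 (R : comNzRingType) (a b c d x x' s y y' t : R) :
    (forall z : R, z + z = 0) ->
  (a * x' + b * y') * (c * x + d * y) + (a * x + b * y) * (c * x' + d * y')
    + ((c * s + d * t) * (a * x' + b * y') + (a * s + b * t) * (c * x' + d * y'))
      * ((c * s + d * t) * (a * x + b * y) + (a * s + b * t) * (c * x + d * y))
  = x' * ((a * d - b * c) * y) + x * ((a * d - b * c) * y')
    + (((a * d - b * c) * t) * x' + s * ((a * d - b * c) * y'))
      * (((a * d - b * c) * t) * x + s * ((a * d - b * c) * y)).
Proof.
move=> zz.
have E (u v w : R) : v + w + w = v by rewrite -addrA zz addr0.
(* Each of the three pieces differs from its target by a sum taken twice, which [E] removes. *)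
have -> : (c * s + d * t) * (a * x' + b * y') + (a * s + b * t) * (c * x' + d * y') =
  ((a * d - b * c) * t) * x' + s * ((a * d - b * c) * y')
  + (a * c * s * x' + b * c * t * x' + b * c * s * y' + b * d * t * y')
  + (a * c * s * x' + b * c * t * x' + b * c * s * y' + b * d * t * y') by ring.
have -> : (c * s + d * t) * (a * x + b * y) + (a * s + b * t) * (c * x + d * y) =
  ((a * d - b * c) * t) * x + s * ((a * d - b * c) * y)
  + (a * c * s * x + b * c * t * x + b * c * s * y + b * d * t * y)
  + (a * c * s * x + b * c * t * x + b * c * s * y + b * d * t * y) by ring.
have -> : (a * x' + b * y') * (c * x + d * y) + (a * x + b * y) * (c * x' + d * y') =
 x' * ((a * d - b * c) * y) + x * ((a * d - b * c) * y')
  + (a * c * x * x' + b * d * y * y' + b * c * (x' * y + x * y')) 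
  + (a * c * x * x' + b * d * y * y' + b * c * (x' * y + x * y')) by ring.
by rewrite !E.
Qed.

Lemma dim_plane (K : fieldType) (vT : vectType K) (p w : vT) :
  p != 0 -> w \notin <[p]>%VS -> \dim (<[p]> + <[w]>)%VS = 2%N.
Proof.
move=> p0 wp; have w0 : w != 0 by apply: contraNneq wp => ->; rewrite mem0v.
apply/eqP; rewrite eqn_leq; apply/andP; split.
  by apply: leq_trans (dimv_add_leqif _ _) _; rewrite !dim_vline p0 w0.
rewrite ltnNge; apply: contra wp => dim_le1.
have /eqP -> : <[p]>%VS == (<[p]> + <[w]>)%VS by rewrite eqEdim addvSl dim_vline p0.
by rewrite (subvP (addvSr _ _)) ?memv_line.
Qed.

(** * The form [moore] and its values on planes *)

Section MooreColoring.

Variables (e q : nat) (F : finFieldType) (L : fieldExtType F).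
Hypotheses (qE : q = (2 ^ e)%N) (cardF : #|F| = q) (odd_dimL : odd (\dim {:L})).

Lemma pchar2_ext : 2 \in [pchar L].
Proof. by rewrite pchar_lalg (card_finPcharP (n := e)) ?cardF. Qed.

Lemma frobD (x y : L) : (x + y) ^+ q = x ^+ q + y ^+ q.
Proof. by rewrite exprDn_pchar // qE pnatX pnatE ?pchar2_ext. Qed.

Lemma frob_fixedP (x : L) : reflect (exists c : F, x = c%:A) (x ^+ q == x).
Proof.
have := Fermat's_little_theorem 1%AS x.
by rewrite dimv1 expn1 cardF => <-; apply: (iffP (vlineP _ _)).
Qed.

Lemma frob_alg (c : F) : c%:A ^+ q = c%:A :> L.
Proof. by apply/eqP/frob_fixedP; exists c. Qed.

(** If the degree of [L] is 2i + 1, then x = x^(q^(2i+1)) = (x^(q^(2i)))^q = x^q. *)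
Lemma frob_involutive_fixed (x : L) : x ^+ q ^+ q = x -> x ^+ q = x.
Proof.
move=> xqq; have := Fermat's_little_theorem {:L}%AS x.
rewrite memvf cardF -(odd_double_half (\dim {:L})) odd_dimL /=.
rewrite add1n expnSr exprM -mul2n expnM => /esym/eqP xqd.
rewrite -[RHS]xqd; congr (_ ^+ q); rewrite -exprM in xqq.
elim: (_./2) => [|i IHi]; first by rewrite expn0 expr1.
by rewrite expnSr exprM -IHi -mulnn xqq.
Qed.

Lemma addrr_ext (x : L) : x + x = 0.
Proof. exact: (addrr_pchar2 pchar2_ext). Qed.

Lemma oppr_ext (x : L) : - x = x.
Proof. exact: (oppr_pchar2 pchar2_ext). Qed.

Lemma frobB (x y : L) : (x - y) ^+ q = x ^+ q - y ^+ q.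
Proof. by rewrite -[- y]oppr_ext opprK frobD oppr_ext. Qed.

(** The quotient z satisfies z^q = 1/z, so z^(q^2) = z; odd degree gives z^q = z, hence z^2 = 1, and
    z = 1 in characteristic 2. *)
Lemma expr_q1_inj (x y : L) : x ^+ q.+1 = y ^+ q.+1 -> x = y.
Proof.
have [->|y0] := eqVneq y 0.
  by rewrite [RHS]expr0n => /eqP; rewrite expf_eq0 => /andP[_ /eqP].
move=> eq_xy; set z := x / y.
have zq1 : z ^+ q * z = 1.
  by rewrite -exprSr expr_div_n eq_xy divff // expf_neq0.
have z0 : z != 0 by apply: contra_eq_neq zq1 => ->; rewrite mulr0 eq_sym oner_neq0.
have zV : z ^+ q = z^-1 by apply: (mulIf z0); rewrite zq1 mulVf.
have zz : z ^+ q = z by apply: frob_involutive_fixed; rewrite {1}zV exprVn zV invrK.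
have z1 : z = 1.
  by apply/eqP; move/eqP: zq1; rewrite zz -expr2 sqrf_eq1 oppr_ext orbb.
by rewrite -[LHS](divfK y0) -/z z1 mul1r.
Qed.

Variables (V : vectType F) (X S : {linear V -> L}).
Hypothesis frobS : forall v, S v ^+ q = S v.
Hypothesis XS_inj : forall v, X v = 0 -> S v = 0 -> v = 0.

(* [V] is embedded in [L * L] by [(X, S)], with [S] valued in the copy of [F] in [L]. *)
Definition moore u v :=
  X u ^+ q * X v + X u * X v ^+ q + (S v * X u + S u * X v) ^+ q.+1.

Let XZ (a : F) v : X (a *: v) = a%:A * X v.
Proof. by rewrite linearZ mulr_algl. Qed.

Let SZ (a : F) v : S (a *: v) = a%:A * S v.
Proof. by rewrite linearZ mulr_algl. Qed.

Let XqZ (a : F) v : X (a *: v) ^+ q = a%:A * X v ^+ q.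
Proof. by rewrite XZ exprMn frob_alg. Qed.

Lemma mooreE u v : moore u v = X u ^+ q * X v + X u * X v ^+ q
  + (S v * X u ^+ q + S u * X v ^+ q) * (S v * X u + S u * X v).
Proof. by rewrite /moore exprSr frobD !exprMn !frobS. Qed.

(** A change of generators acts through its determinant, so all values on a plane can be rewritten
    with one chosen first argument. *)
Lemma moore_det p w (a b c d : F) :
  moore (a *: p + b *: w) (c *: p + d *: w) = moore p ((a * d - b * c) *: w).
Proof.
rewrite !mooreE !(linearD X) !(linearD S) !frobD !XqZ !XZ !SZ.
have -> : (a * d - b * c)%:A = a%:A * d%:A - b%:A * c%:A :> L.
  by rewrite -!(in_algE L) rmorphB !rmorphM.
exact: moore_det_char2 addrr_ext.
Qed.

Let XSB_eq u v w (c : L) : c ^+ q = c -> X v - X w = c * X u ->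
  S v - S w = c * S u -> exists a : F, v - w = a *: u.
Proof.
move=> /eqP/frob_fixedP[a ->] eqX eqS; exists a; apply: subr0_eq.
by apply: XS_inj; rewrite !linearB /= ?XZ ?SZ ?eqX ?eqS subrr.
Qed.

Lemma moore0 u : moore u 0 = 0.
Proof.
rewrite -[in LHS](scale0r (0 : V)) mooreE XqZ XZ SZ !scale0r.
by rewrite !(mul0r, mulr0, addr0).
Qed.

Lemma moore_eq u v w : u != 0 -> moore u v = moore u w ->
  exists a : F, v - w = a *: u.
Proof.
move=> u0; have [s0|s0] := eqVneq (S u) 0.
  have x0 : X u != 0 by apply: contra_neq u0 => x0; apply: XS_inj.
  rewrite !mooreE s0 !mul0r !addr0 => eq_uvw.
  (* Dividing by [X u ^+ q.+1] leaves h^q = h + k^2. As k^q = k, a second Frobenius gives h^(q^2) =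
     h, so h^q = h and k = 0. *)
  set h := (X v - X w) / X u; set k := S v - S w.
  have hq : h ^+ q = h + k ^+ 2.
    rewrite /h /k expr_div_n frobB; apply: (mulfI (mulf_neq0 x0 (expf_neq0 q x0))).
    (* [field] ignores the characteristic, so what cancels only in characteristic 2 is isolated as
       [z + z]. *)
    apply: subr0_eq; set z := X u ^+ q * (X v - X w)
      + X u * X u ^+ q * S v * (S v - S w).
    rewrite [LHS](_ : _ = (X u ^+ q * X v + X u * X v ^+ q
        + S v * X u ^+ q * (S v * X u)) - (X u ^+ q * X w + X u * X w ^+ q
        + S w * X u ^+ q * (S w * X u)) - (z + z)).
      by rewrite eq_uvw subrr addrr_ext subrr.
    by rewrite /z; field; rewrite x0 expf_neq0.
  have kq : k ^+ q = k by rewrite frobB !frobS.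
  have hh : h ^+ q = h.
    apply: frob_involutive_fixed.
    by rewrite hq frobD hq -exprM mulnC exprM kq -addrA addrr_ext addr0.
  have k0 : k = 0 by apply/eqP; rewrite -sqrf_eq0 -(inj_eq (addrI h)) -hq hh addr0.
  apply: (XSB_eq (u := u) hh); first by rewrite divfK.
  by rewrite s0 mulr0.
(* When [S u] is nonzero, scaling by [S u ^+ 2] and adding [X u ^+ q.+1] completes [moore u v'] to a
   (q+1)-th power, to which [expr_q1_inj] applies. *)
pose D v' := S v' * X u + S u * X v'.
have E v' : (S u * D v' + X u) ^+ q.+1 = S u ^+ 2 * moore u v' + X u ^+ q.+1.
  rewrite mooreE !(exprSr _ q) /D !(frobD, exprMn) !frobS.
  set z := S u * S v' * X u ^+ q * X u.
  rewrite [LHS](_ : _ = S u ^+ 2 * (X u ^+ q * X v' + X u * X v' ^+ q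
    + (S v' * X u ^+ q + S u * X v' ^+ q) * (S v' * X u + S u * X v'))
    + X u ^+ q * X u + (z + z)); first by rewrite addrr_ext addr0.
  by rewrite /z; ring.
move=> eq_uvw; have /expr_q1_inj/addIr/(mulfI s0) eqD :
    (S u * D v + X u) ^+ q.+1 = (S u * D w + X u) ^+ q.+1 by rewrite !E eq_uvw.
apply: (XSB_eq (u := u) (c := (S v - S w) / S u)).
- by rewrite expr_div_n frobB !frobS.
- rewrite -[LHS]oppr_ext; apply: (mulfI s0); apply: subr0_eq.
  rewrite [LHS](_ : _ = D w - D v); first by rewrite eqD subrr.
  by rewrite /D; field.
- by rewrite divfK.
Qed.

(** Only the last summand of [moore] is not linear in the scalar; it is quadratic, and squaring is
    additive in characteristic 2. *)
Lemma moore_scaleD u v (c d : F) :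
  moore u ((c + d) *: v) = moore u (c *: v) + moore u (d *: v).
Proof.
rewrite !mooreE !XqZ !XZ !SZ.
have -> : (c + d)%:A = c%:A + d%:A :> L by rewrite scalerDl.
set N := (S v * X u ^+ q + S u * X v ^+ q) * (S v * X u + S u * X v).
rewrite [RHS](_ : _ = X u ^+ q * ((c%:A + d%:A) * X v)
  + X u * ((c%:A + d%:A) * X v ^+ q) + (c%:A ^+ 2 + d%:A ^+ 2) * N); last first.
  by rewrite /N; ring.
rewrite [LHS](_ : _ = X u ^+ q * ((c%:A + d%:A) * X v)
  + X u * ((c%:A + d%:A) * X v ^+ q) + (c%:A ^+ 2 + d%:A ^+ 2) * N
  + (c%:A * d%:A * N + c%:A * d%:A * N)); first by rewrite addrr_ext addr0.
by rewrite /N; ring.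
Qed.

(* [c |-> lam (moore u (c *: v))] is an additive endomap of [F]: if it is injective
   it attains [1], and otherwise it has a nonzero kernel. *)
Lemma moore_hits (lam : {linear L -> F^o}) u v :
    (forall c : F, moore u (c *: v) = 0 -> c = 0) ->
  exists2 c : F, c != 0 &
    (lam (moore u (c *: v)) == 0) || (lam (moore u (c *: v)) == 1).
Proof.
move=> moore0; pose g c : F := lam (moore u (c *: v)).
have gD c d : g (c + d) = g c + g d by rewrite /g moore_scaleD linearD.
have g0 : g 0 = 0 by apply: (addrI (g 0)); rewrite -gD !addr0.
have [/injectiveP g_inj|/injectivePn[c [d neq_cd eq_g]]] := boolP (injectiveb g).
  have [g' gK g'K] := injF_bij g_inj.
  exists (g' 1); last by rewrite -/(g _) g'K eqxx orbT.
  by apply: contra_eq_neq (g'K 1) => ->; rewrite g0 eq_sym oner_neq0.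
exists (c - d); first by rewrite subr_eq0.
by rewrite -/(g _) -(inj_eq (addIr (g d))) -gD subrK eq_g add0r eqxx.
Qed.

Lemma plane_basis (U : {vspace V}) p : \dim U = 2%N -> p \in U -> p != 0 ->
  exists2 w, w \notin <[p]>%VS & U = (<[p]> + <[w]>)%VS.
Proof.
move=> dimU pU p0.
have /subvPn[w wU wp] : ~~ (U <= <[p]>)%VS.
  by apply: contraL (p0) => /dimvS; rewrite dimU dim_vline; case: (p != 0).
exists w => //; apply/esym/eqP; rewrite eqEdim subv_add -!memvE pU wU.
by rewrite dim_plane ?dimU.
Qed.

(** Supplies the colour of [U]. [moore_hits] applies because a zero value at [c *: w] equals the
    value at 0, which by [moore_eq] would put [c *: w] on the line of the first argument. *)
Lemma plane_moore_hits (lam : {linear L -> F^o}) (U : {vspace V}) :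
    \dim U = 2%N ->
  exists u v, [/\ u \in U, v \in U, moore u v != 0 &
    (lam (moore u v) == 0) || (lam (moore u v) == 1)].
Proof.
move=> dimU; have U0 : U != 0%VS by rewrite -dimv_eq0 dimU.
have p0 : vpick U != 0 by rewrite vpick0.
have [w wp defU] := plane_basis dimU (memv_pick U) p0.
have moore_w0 c : moore (vpick U) (c *: w) = 0 -> c = 0.
  move=> eq0; have [|a] := moore_eq (u := vpick U) (v := c *: w) (w := 0) p0.
    by rewrite eq0 moore0.
  rewrite subr0 => cw; apply: contraNeq wp => c0; apply/vlineP.
  by exists (c^-1 * a); rewrite -scalerA -cw scalerA mulVf ?scale1r.
have [c c0 hit] := moore_hits lam moore_w0.
exists (vpick U), (c *: w); split=> //; first exact: memv_pick.
  by apply: memvZ; rewrite defU (subvP (addvSr _ _)) ?memv_line.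
by apply: contra_neq c0 => /moore_w0.
Qed.

Lemma plane_moore_basepoint (U : {vspace V}) p u v : \dim U = 2%N -> p != 0 ->
    p \in U -> u \in U -> v \in U ->
  exists2 w, w \in U & moore u v = moore p w.
Proof.
move=> dimU p0 pU uU vU; have [w _ defU] := plane_basis dimU pU p0.
have wU : w \in U by rewrite defU (subvP (addvSr _ _)) ?memv_line.
move: uU vU; rewrite defU.
move=> /memv_addP[_ /vlineP[a ->] [_ /vlineP[b ->] ->]].
move=> /memv_addP[_ /vlineP[c ->] [_ /vlineP[d ->] ->]].
by rewrite moore_det -defU; exists ((a * d - b * c) *: w); first exact: memvZ.
Qed.

(** Both values can be based at a common [p]. Then [moore_eq] puts [w] in both planes, hence on the
    line of [p], where [moore p] vanishes by [moore_det]. *)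
Lemma moore_plane_disjoint (U U' : {vspace V}) u v u' v' :
    \dim U = 2%N -> \dim U' = 2%N -> \dim (U :&: U')%VS = 1%N ->
    u \in U -> v \in U -> u' \in U' -> v' \in U' ->
  moore u v = moore u' v' -> moore u v = 0.
Proof.
move=> dimU dimU' dimI uU vU u'U' v'U'.
set p := vpick (U :&: U')%VS.
have p0 : p != 0 by rewrite vpick0 -dimv_eq0 dimI.
have /[!memv_cap]/andP[pU pU'] : p \in (U :&: U')%VS by exact: memv_pick.
have [w wU ->] := plane_moore_basepoint dimU p0 pU uU vU.
have [w' w'U ->] := plane_moore_basepoint dimU' p0 pU' u'U' v'U'.
move=> eq_ww'; have [a defw] := moore_eq p0 eq_ww'.
have : w \in (U :&: U')%VS.
  by rewrite memv_cap wU -(subrK w' w) defw memvD ?memvZ.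
have -> : (U :&: U')%VS = <[p]>%VS.
  by apply/esym/eqP; rewrite eqEdim -memvE memv_pick dimI dim_vline p0.
case/vlineP=> b ->; have := moore_det p 0 1 0 b 0.
by rewrite !scaler0 !addr0 scale1r moore0.
Qed.

End MooreColoring.

(** * The upper bound *)

Lemma gauss_binom1_ge q m :
  (1 < q)%N -> (0 < m)%N -> (q ^ m.-1 <= gauss_binom1 q m)%N.
Proof.
case: m => // m q_gt1 _; have q_gt0 := ltnW q_gt1.
rewrite -(@leq_pmul2r (q - 1)) ?subn_gt0 // -(leq_add2r 1) gauss_binom1_exact //=.
by have : (0 < q ^ m)%N; [rewrite expn_gt0 q_gt0 | rewrite expnS; nia].
Qed.

Lemma chromatic_number_lt (e q n : nat) (F : finFieldType) :
    q = (2 ^ e)%N -> #|F| = q -> (0 < n)%N -> ~~ odd n ->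
  (chromatic_number (grassmann_graph2 F n) < 2 * gauss_binom1 q (n - 1))%N.
Proof.
case: n => // n qE cardF _ /=; rewrite negbK subn1 /= => odd_n.
have n_gt0 : (0 < n)%N by case: (n) odd_n.
have q_gt1 : (1 < q)%N by rewrite -cardF finNzRing_gt1.
have [L dimL] := fieldExt_of_degree F n_gt0; rewrite dimvf in dimL.
have odd_dimL : odd (\dim {:L}) by rewrite dimvf dimL.
(* Trading [n] for [dim L] makes rows of length [n] the coordinate rows of [L], with no cast. *)
move: odd_n n_gt0; rewrite -dimL => {n dimL} odd_n n_gt0.
set n := dim L in odd_n n_gt0 *.
pose V := 'rV[F]_(1 + n).
pose Xf (v : V) : L := @r2v F L (rsubmx v).
have X_lin : linear Xf.
  by move=> a u v; rewrite /Xf linearP /= linearP.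
pose Sf (v : V) : L := (lsubmx v 0 0)%:A.
have S_lin : linear Sf.
  by move=> a u v; rewrite /Sf linearP !mxE scalerDl scalerA.
pose i0 : 'I_n := Ordinal n_gt0.
pose lamf (x : L) : F^o := v2r x 0 i0.
have lam_lin : linear lamf.
  by move=> a x y; rewrite /lamf linearP !mxE.
pose X : {linear V -> L} := HB.pack Xf
  (GRing.isLinear.Build F V L *:%R Xf X_lin).
pose S : {linear V -> L} := HB.pack Sf
  (GRing.isLinear.Build F V L *:%R Sf S_lin).
pose lam : {linear L -> F^o} := HB.pack lamf
  (GRing.isLinear.Build F L F^o *:%R lamf lam_lin).
have frobS v : S v ^+ q = S v by apply: frob_alg.
have XS_inj v : X v = 0 -> S v = 0 -> v = 0.
  rewrite /= /Xf /Sf => X0 /eqP S0; rewrite -[v]hsubmxK.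
  have -> : rsubmx v = 0 by apply: (can_inj r2vK); rewrite X0 linear0.
  have -> : lsubmx v = 0.
    apply/matrixP => i j; rewrite !ord1; move: S0.
    by rewrite scaler_eq0 oner_eq0 orbF => /eqP ->; rewrite mxE.
  by rewrite row_mx0.
set G := grassmann_graph2 F n.+1.
(* Removing the zero row makes the final inequality strict. *)
pose A := [set r : 'rV[F]_n | (r 0 i0 == 0) || (r 0 i0 == 1)] :\ 0.
have cardA : (#|A| < 2 * gauss_binom1 q n)%N.
  have : (#|A| < #|[set r : 'rV[F]_n | ((r 0%R i0 == 0) || (r 0%R i0 == 1))%R]|)%N.
    by apply/proper_card/properD1; rewrite inE mxE eqxx.
  move/leq_trans; apply; apply: leq_trans (card_row_entry_bool F i0) _.
  by rewrite cardF leq_mul2l gauss_binom1_ge.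
pose isc (U : G) (r : 'rV[F]_n) := r \in A /\
  exists u v, [/\ u \in val U, v \in val U & r = v2r (moore q X S u v)].
have [c cP] : exists c : G -> 'rV[F]_n, forall U, isc U (c U).
  apply: fin_all_exists => U.
  have [u [v [uU vU uv0 uv1]]] :=
    plane_moore_hits qE cardF odd_dimL frobS XS_inj lam (eqP (valP U)).
  exists (v2r (moore q X S u v)); split; last by exists u, v.
  by rewrite !inE uv1 andbT -(inj_eq (can_inj r2vK)) v2rK linear0.
apply: leq_ltn_trans cardA; apply: chromatic_number_le.
apply: (@colorable_in G _ A c) => [U|U U' adjUU' eqc]; first by case: (cP U).
have [cA [u [v [uU vU cU]]]] := cP U.
have [_ [u' [v' [uU' vU' cU']]]] := cP U'.
(* A colour shared by adjacent planes would be zero, which [A] excludes. *)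
have := moore_plane_disjoint qE cardF odd_dimL frobS XS_inj
  (eqP (valP U)) (eqP (valP U')) (eqP adjUU') uU vU uU' vU'.
move=> uv0; move: cA; rewrite cU uv0 ?linear0 ?inE ?eqxx //.
by apply: (can_inj v2rK); rewrite -cU -cU'.
Qed.

(** * The lower bound *)

Lemma card_line_le (F : finFieldType) n (p : 'rV[F]_n) :
  (#|[set w : 'rV[F]_n | w \in <[p]>%VS]| <= #|F|)%N.
Proof.
apply: leq_trans (leq_imset_card (fun a : F => a *: p) predT); apply: subset_leq_card.
by apply/subsetP => w; rewrite inE => /vlineP[a ->]; apply/imsetP; exists a.
Qed.

(** An intersection of dimension above 1 fills both planes. Hence the planes through a point form a
    clique. *)
Lemma plane_adjP (F : finFieldType) n (U U' : plane F n) p :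
  p != 0 -> p \in val U -> p \in val U' -> (U == U') || plane_adj U U'.
Proof.
move=> p0 pU pU'; rewrite /plane_adj -val_eqE /=.
have dimU := eqP (valP U); have dimU' := eqP (valP U').
have pI : (<[p]> <= val U :&: val U')%VS by rewrite -memvE memv_cap pU.
have := dimvS pI; rewrite dim_vline p0 leq_eqVlt eq_sym orbC => /orP[dimI|->].
  have eqI V : \dim V = 2%N -> (val U :&: val U' <= V)%VS -> (val U :&: val U')%VS = V.
    by move=> dimV sIV; apply/eqP; rewrite eqEdim sIV dimV.
  by rewrite -{1}(eqI _ dimU (capvSl _ _)) {1}(eqI _ dimU' (capvSr _ _)) eqxx.
by rewrite orbT.
Qed.

(** Vectors off the line of [p] are counted instead of planes through [p]: there are at least q^n -
    q of them, and each colour accounts for at most q(q - 1). *)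
Lemma chromatic_number_ge (F : finFieldType) n : (0 < n)%N ->
  (gauss_binom1 #|F| (n - 1) <= chromatic_number (grassmann_graph2 F n))%N.
Proof.
case: n => // n _; rewrite subn1 /=; set q := #|F|.
set k := chromatic_number _.
have q_gt1 : (1 < q)%N := finNzRing_gt1 F; have q_gt0 := ltnW q_gt1.
have /existsP[c /forallP cP] := chromatic_number_colorable (grassmann_graph2 F n.+1).
pose p : 'rV[F]_n.+1 := const_mx 1.
have p0 : p != 0 by apply/eqP => /rowP/(_ 0)/eqP; rewrite !mxE oner_eq0.
pose W := [set w : 'rV[F]_n.+1 | w \notin <[p]>%VS].
have cardW : (q ^ n.+1 <= #|W| + q)%N.
  rewrite -[X in (q ^ X)%N]mul1n -card_mx -(cardsC W) leq_add2l.
  apply: leq_trans (card_line_le p); apply: subset_leq_card.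
  by apply/subsetP => w; rewrite !inE negbK.
pose Wc i := [set w in W | [exists U : plane F n.+1,
  (val U == <[p]> + <[w]>)%VS && (c U == i)]].
have card_Wc i : (#|Wc i| <= q * q.-1)%N.
  have [->|[w0]] := set_0Vmem (Wc i); first by rewrite cards0.
  rewrite !inE => /andP[_ /existsP[U0 /andP[/eqP defU0 /eqP cU0]]].
  have -> : (q * q.-1)%N = #|setX [set: F] [set~ (0 : F)]|.
    by rewrite cardsX cardsT cardsC1.
  (* All planes of colour [i] through [p] equal [U0], so [w] is a combination of [p] and [w0], with
     nonzero coefficient at [w0]. *)
  apply: leq_trans (leq_imset_card (fun ab : F * F => ab.1 *: p + ab.2 *: w0) _).
  apply: subset_leq_card; apply/subsetP => w.
  rewrite !inE => /andP[wp /existsP[U /andP[/eqP defU /eqP cU]]].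
  have pU : p \in val U by rewrite defU (subvP (addvSl _ _)) ?memv_line.
  have pU0 : p \in val U0 by rewrite defU0 (subvP (addvSl _ _)) ?memv_line.
  have : w \in val U by rewrite defU (subvP (addvSr _ _)) ?memv_line.
  have [/eqP ->|adjU] := orP (plane_adjP p0 pU pU0); last first.
    by have /forallP/(_ U0)/implyP/(_ adjU) := cP U; rewrite cU cU0 eqxx.
  rewrite defU0 => /memv_addP[_ /vlineP[a ->] [_ /vlineP[b ->] defw]].
  apply/imsetP; exists (a, b) => //; rewrite !inE /=.
  by apply: contraNneq wp => b0; rewrite defw b0 scale0r addr0 memvZ ?memv_line.
have W_le : (#|W| <= k * (q * q.-1))%N.
  have /subset_leq_card/leq_trans : W \subset \bigcup_(i : 'I_k) Wc i.
    apply/subsetP => w wW; have dim_pw := dim_plane p0 (etrans (esym (in_set _ _)) wW).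
    pose U : plane F n.+1 := exist _ (<[p]> + <[w]>)%VS (introT eqP dim_pw).
    apply/bigcupP; exists (c U) => //; rewrite inE wW.
    by apply/existsP; exists U; rewrite !eqxx.
  apply; rewrite -[k in X in (_ <= X)%N]card_ord -sum_nat_const.
  pose small (A : {set 'rV[F]_n.+1}) m := (#|A| <= m)%N.
  apply: (big_ind2 small) => [|A a B b leA leB|i _].
  - by rewrite /small cards0.
  - by apply: leq_trans (leq_card_setU _ _) (leq_add leA leB).
  - exact: card_Wc.
have gE := gauss_binom1_exact n q_gt0.
rewrite -(@leq_pmul2r (q * (q - 1))%N) ?muln_gt0 ?q_gt0 ?subn_gt0 //.
(* By [gE] the total q^(n+1) is g q(q - 1) + q, with g the Gaussian binomial, so the two counts
   compare g with [k]. *)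
rewrite subn1 in gE *; rewrite expnS -gE in cardW; nia.
Qed.

Local Close Scope ring_scope.

Theorem theorem1p3 (e q n : nat) (F : finFieldType) (he : 0 < e)
    (hq : q = 2 ^ e) (hF : #|F| = q) (hn : 0 < n) (hn2 : ~~ odd n) :
  gauss_binom1 q (n - 1) <= chromatic_number (grassmann_graph2 F n)
    < 2 * gauss_binom1 q (n - 1).
Proof.
by rewrite (chromatic_number_lt hq hF hn hn2) -hF chromatic_number_ge.
Qed.
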